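(* Let $k$ be a commutative ring of characteristic $2$ and let $G=(\mathbb{Z}/2)^r$ with $r\ge 1$. Let $(A^*_\times,d)$ be the cochain complex computing the twist cohomology of $k[G]$, with $A^n_\times=k[G^n]^\times$. Then $H^n(A^*_\times,d)=0$ for all $n\ge 3$.
   Context: For each $n\ge 0$, let $A^n=k[G^n]\cong k[G]^{\otimes n}$ (so $A^0=k$) and let $A^n_\times$ be its (abelian, multiplicative) group of units. The cofaces $d^i:A^n\to A^{n+1}$, $0\le i\le n+1$, are the $k$-algebra homomorphisms given on group elements by $d^0(g_1,\dots,g_n)=(1,g_1,\dots,g_n)$, $d^i(g_1,\dots,g_n)=(g_1,\dots,g_i,g_i,\dots,g_n)$ for $1\le i\le n$ (doubling the $i$-th entry), and $d^{n+1}(g_1,\dots,g_n)=(g_1,\dots,g_n,1)$. The differential $d:A^n_\times\to A^{n+1}_\times$ is the alternating product $d=\prod_{i=0}^{n+1}(d^i)^{(-1)^i}$. *)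

(* Defs.v *)
From HB Require Import structures.
From mathcomp Require Import all_boot all_order all_algebra.
From mathcomp Require Import boolp classical_sets.

Set Implicit Arguments.
Unset Strict Implicit.
Unset Printing Implicit Defensive.

Import GRing.Theory.
Local Open Scope ring_scope.
Local Open Scope classical_set_scope.

HB.instance Definition _ (I : finType) (G : finZmodType) :=
  Finite.on {ffun I -> G}.

(* The group algebra k[G] of a finite abelian group G (written additively):
   the function x : G -> k stands for the formal sum of the x g *: [g], and
   [g] * [h] = [g + h].  The alias hides the pointwise product of
   {ffun G -> k}; its inverse is chosen classically. *)
Definition galg (k : comNzRingType) (G : finZmodType) := {ffun G -> k}.

Section GroupAlgebra.
Variables (k : comNzRingType) (G : finZmodType).
Local Notation A := (galg k G).
Implicit Types (x y z : A) (g h : G).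

HB.instance Definition _ := GRing.Lmodule.copy A {ffun G -> k^o}.

Definition gbase g : A := [ffun h => (h == g)%:R].

Definition gmul x y : A := [ffun h => \sum_g x g * y (h - g)].

Fact gmulC : commutative gmul.
Proof.
move=> x y; apply/ffunP => h; rewrite !ffunE.
rewrite (reindex_inj (inj_comp (addrI h) (@oppr_inj _))) /=.
by apply: eq_bigr => g _; rewrite subKr mulrC.
Qed.

Fact gmulA : associative gmul.
Proof.
move=> x y z; apply/ffunP => h; rewrite !ffunE.
under eq_bigr => g _ do rewrite ffunE big_distrr /=.
under [RHS]eq_bigr => g _ do rewrite ffunE big_distrl /=.
rewrite [RHS]exchange_big /=; apply: eq_bigr => g _.
rewrite [RHS](reindex_inj (addrI g)) /=; apply: eq_bigr => j _.
by rewrite mulrA opprD addrA [g + j]addrC addrK.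
Qed.

Fact gmul1 : left_id (gbase 0) gmul.
Proof.
move=> x; apply/ffunP => h; rewrite ffunE (bigD1 0) //= ffunE eqxx mul1r subr0.
by rewrite big1 ?addr0 // => g /negPf g0; rewrite ffunE g0 mul0r.
Qed.

Fact gmulDl : left_distributive gmul +%R.
Proof.
move=> x y z; apply/ffunP => h; rewrite !ffunE -big_split.
by apply: eq_bigr => g _; rewrite ffunE mulrDl.
Qed.

Fact gbase0_neq0 : gbase 0 != 0 :> A.
Proof. by apply/eqP => /ffunP/(_ 0)/eqP; rewrite !ffunE eqxx oner_eq0. Qed.

HB.instance Definition _ := GRing.Zmodule_isComNzRing.Build A
  gmulA gmulC gmul1 gmulDl gbase0_neq0.

Fact gscaleAl (a : k) x y : a *: (x * y) = a *: x * y.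
Proof.
apply/ffunP => h; rewrite !ffunE /GRing.scale /= big_distrr /=.
by apply: eq_bigr => g _; rewrite ffunE mulrA.
Qed.

HB.instance Definition _ := GRing.Lmodule_isLalgebra.Build k A gscaleAl.
HB.instance Definition _ := GRing.Lalgebra_isComAlgebra.Build k A.

Definition gunit : pred A := fun x => `[< exists y, y * x = 1 >].

Definition ginv x : A :=
  if pselect (exists y, y * x = 1) is left e then projT1 (cid e) else x.

Fact gmulVr : {in gunit, left_inverse 1 ginv *%R}.
Proof.
move=> x /asboolP Ux; rewrite /ginv; case: pselect => // e.
exact: projT2 (cid e).
Qed.

Fact gunitP x y : y * x = 1 -> gunit x.
Proof. by move=> yx1; apply/asboolP; exists y. Qed.

Fact ginv_out : {in [predC gunit], ginv =1 id}.
Proof.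
by move=> x /asboolPn nUx; rewrite /ginv; case: pselect => // /nUx.
Qed.

HB.instance Definition _ := GRing.ComNzRing_hasMulInverse.Build A
  gmulVr gunitP ginv_out.

End GroupAlgebra.


(* The k-linear map k[G] -> k[H] sending the group element [g] to [f g]. *)
Definition gmap (k : comNzRingType) (G H : finZmodType) (f : G -> H)
    (x : galg k G) : galg k H :=
  [ffun h => \sum_(g | f g == h) x g].

Section GroupAlgebraMap.
Variable k : comNzRingType.

Lemma gmap_comp (G H K : finZmodType) (f : H -> K) (g : G -> H) (x : galg k G) :
  gmap f (gmap g x) = gmap (f \o g) x.
Proof.
apply/ffunP => u; rewrite !ffunE.
under eq_bigr => v _ do rewrite ffunE.
rewrite (exchange_big_dep (fun w => f (g w) == u)) /=; last first.
  by move=> v w fv /eqP ->.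
apply: eq_bigr => w fgw; rewrite (big_pred1 (g w)) // => v /=.
by rewrite [g w == v]eq_sym; case: (eqVneq v (g w)) => [->|_]; rewrite ?fgw ?andbF.
Qed.

Lemma eq_gmap (G H : finZmodType) (f g : G -> H) :
  f =1 g -> gmap (k := k) f =1 gmap g.
Proof.
by move=> fg x; apply/ffunP => h; rewrite !ffunE; apply: eq_bigl => u; rewrite fg.
Qed.

Section Additive.
Variables (G H : finZmodType) (f : {additive G -> H}).

Lemma gmap_gbase g : gmap f (gbase k g) = gbase k (f g).
Proof.
apply/ffunP => h; rewrite !ffunE [h == _]eq_sym.
have [<-|fgh] := eqVneq (f g) h.
  rewrite (bigD1 g) //= ffunE eqxx big1 ?addr0 // => u /andP[_ /negPf ug].
  by rewrite ffunE ug.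
rewrite big1 // => u /eqP fuh; rewrite ffunE.
by case: eqP => // ug; rewrite -fuh ug eqxx in fgh.
Qed.

Fact gmap_is_linear : linear (gmap (k := k) f).
Proof.
move=> a x y; apply/ffunP => h; rewrite !ffunE scaler_sumr -big_split.
by apply: eq_bigr => g _; rewrite !ffunE.
Qed.

HB.instance Definition _ :=
  GRing.isLinear.Build k (galg k G) (galg k H) *:%R (gmap f) gmap_is_linear.

Fact gmap_is_monoid_morphism : monoid_morphism (gmap (k := k) f).
Proof.
split=> [|x y]; first by rewrite [LHS]gmap_gbase raddf0.
apply/ffunP => h; rewrite !ffunE.
under eq_bigr => u _ do rewrite ffunE.
rewrite exchange_big /= [LHS](partition_big f predT) //=.
apply: eq_bigr => v _; rewrite !ffunE big_distrl /=.
apply: eq_bigr => u /eqP <-; rewrite (reindex_inj (addrI u)) /= big_distrr /=.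
apply: eq_big => [w|w _]; last by rewrite [u + w]addrC addrK.
by rewrite raddfD [f u + _]addrC [RHS]eq_sym subr_eq eq_sym.
Qed.

HB.instance Definition _ :=
  GRing.isMonoidMorphism.Build (galg k G) (galg k H) (gmap f)
    gmap_is_monoid_morphism.

End Additive.
End GroupAlgebraMap.

Section SignedPowers.
Variable R : comUnitRingType.

Lemma prodrXz (I : eqType) (r : seq I) (F : I -> R) (m : int) :
    (forall i, F i \is a GRing.unit) ->
  (\prod_(i <- r) F i) ^ m = \prod_(i <- r) F i ^ m.
Proof.
move=> UF; elim: r => [|i r IHr]; first by rewrite !big_nil exp1rz.
rewrite !big_cons -IHr exprMz_comm ?unitr_prod //; exact: mulrC.
Qed.

End SignedPowers.

Section TwistComplex.
Variables (k : comNzRingType) (G : finZmodType).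

(* The cofaces on group elements; entries are numbered from 0, so the doubled
   entry, the i-th counted from 1, is the last one of take i s and the first
   one of drop i.-1 s. *)
Definition face_seq n (i : nat) (s : seq G) : seq G :=
  if i == 0 then 0 :: s
  else if i == n.+1 then rcons s 0
  else take i s ++ drop i.-1 s.

Definition face n (i : 'I_n.+2) (g : {ffun 'I_n -> G}) : {ffun 'I_n.+1 -> G} :=
  [ffun j : 'I_n.+1 => nth 0 (face_seq n i (fgraph g)) j].

Lemma nth_face n (i : 'I_n.+2) (g : {ffun 'I_n -> G}) m :
  nth 0 (fgraph (face i g)) m =
    if (m < i)%N then nth 0 (fgraph g) m
    else if m == 0 then 0 else nth 0 (fgraph g) m.-1.
Proof.
have sz p (h : {ffun 'I_p -> G}) : size (fgraph h) = p.
  by rewrite size_tuple card_ord.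
have ltin := ltn_ord i.
have [lt_mn|le_nm] := ltnP m n.+1; last first.
  rewrite nth_default ?sz // ltnNge (leq_trans _ le_nm) //=.
  by case: m le_nm => // m; rewrite ltnS /= => le_nm; rewrite nth_default ?sz.
rewrite (nth_fgraph_ord _ (Ordinal lt_mn)) ffunE /= /face_seq.
have [->|i_neq0] := eqVneq (i : nat) 0; first by case: (m).
have [i_eqn|i_neqn] := eqVneq (i : nat) n.+1.
  rewrite i_eqn lt_mn nth_rcons sz; have [//|le_nm] := ltnP m n.
  by rewrite if_same nth_default ?sz.
have lt_in : (i < n.+1)%N by rewrite ltn_neqAle i_neqn -ltnS.
rewrite nth_cat size_takel ?sz //; case: ltnP => [lt_mi|le_im].
  by rewrite nth_take.
case: m le_im {lt_mn} => [|m] le_im; first by rewrite leqn0 (negPf i_neq0) in le_im.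
by rewrite nth_drop -subn1 /= addnBAC ?lt0n // subnKC // subn1.
Qed.

Fact face_is_nmod_morphism n (i : 'I_n.+2) : nmod_morphism (face i).
Proof.
have nthD (g h : {ffun 'I_n -> G}) m :
    nth 0 (fgraph (g + h)) m = nth 0 (fgraph g) m + nth 0 (fgraph h) m.
  have [lt_mn|le_nm] := ltnP m n.
    by rewrite !(nth_fgraph_ord _ (Ordinal lt_mn)) ffunE.
  by rewrite !nth_default ?size_tuple ?card_ord ?addr0.
have nth0 m : nth 0 (fgraph (0 : {ffun 'I_n -> G})) m = 0.
  have [lt_mn|le_nm] := ltnP m n.
    by rewrite !(nth_fgraph_ord _ (Ordinal lt_mn)) ffunE.
  by rewrite nth_default ?size_tuple ?card_ord.
split=> [|g h]; apply/ffunP => j; rewrite -[LHS](nth_fgraph_ord 0) nth_face.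
  by rewrite !nth0 ffunE; case: ifP => // _; case: ifP.
rewrite !nthD [RHS]ffunE -!(nth_fgraph_ord 0 j) !nth_face.
by case: ifP => // _; case: ifP => // _; rewrite addr0.
Qed.

HB.instance Definition _ n (i : 'I_n.+2) :=
  GRing.isNmodMorphism.Build {ffun 'I_n -> G} {ffun 'I_n.+1 -> G} (face i)
    (face_is_nmod_morphism i).

Lemma face_face n (j : 'I_n.+3) (i : 'I_n.+2) (j' : 'I_n.+2) (i' : 'I_n.+3) :
    (i < j)%N -> j' = j.-1 :> nat -> i' = i :> nat ->
  face j \o face i =1 face i' \o face j'.
Proof.
move=> lt_ij ej ei g; apply/ffunP => p.
rewrite -[LHS](nth_fgraph_ord 0) -[RHS](nth_fgraph_ord 0) /= !nth_face ej ei.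
move: (nth 0 (fgraph g)) (p : nat) (i : nat) (j : nat) lt_ij {ej ei} => t {}p {}i {}j.
case: j => // j; rewrite ltnS /= => le_ij; case: p => [|p] /=.
  by case: ifP => // lt_0i; rewrite (leq_trans lt_0i le_ij).
rewrite ltnS; have [lt_pj|le_jp] := ltnP p j.
  by case: ifP => // lt_pi; rewrite (leq_trans lt_pi le_ij).
rewrite ltnNge (leq_trans le_ij le_jp) /= ltnNge (leq_trans le_ij) //=.
exact: leqW.
Qed.

(* A^n = k[G^n]. *)
Definition twist_alg n := galg k {ffun 'I_n -> G}.

Definition coface n (i : 'I_n.+2) : twist_alg n -> twist_alg n.+1 :=
  gmap (face i).

HB.instance Definition _ n (i : 'I_n.+2) :=
  GRing.LRMorphism.copy (coface i) (gmap (k := k) (face i)).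

Definition twist_diff n (x : twist_alg n) : twist_alg n.+1 :=
  \prod_(i < n.+2) coface i x ^ ((-1) ^+ i : int).

Lemma twist_diff_unit n (x : twist_alg n) :
  x \is a GRing.unit -> twist_diff x \is a GRing.unit.
Proof.
by move=> Ux; apply: unitr_prod => i _; apply/unitrXz/rmorph_unit.
Qed.

Lemma twist_diffM n (x y : twist_alg n) :
    x \is a GRing.unit -> y \is a GRing.unit ->
  twist_diff (x * y) = twist_diff x * twist_diff y.
Proof.
move=> Ux Uy; rewrite -big_split; apply: eq_bigr => i _ /=.
by rewrite rmorphM exprMz_comm ?rmorph_unit //; apply: mulrC.
Qed.

Lemma twist_diffK n (x : twist_alg n) :
  x \is a GRing.unit -> twist_diff (twist_diff x) = 1.
Proof.
move=> Ux; pose U := (rmorph_unit, unitrXz).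
pose F (p : 'I_n.+3 * 'I_n.+2) :=
  coface p.1 (coface p.2 x) ^ ((-1) ^+ (p.1 + p.2) : int).
have UF p : F p \is a GRing.unit by rewrite !U.
have -> : twist_diff (twist_diff x) = \prod_p F p.
  rewrite -(pair_bigA _ (fun j i => F (j, i))); apply: eq_bigr => j _ /=.
  rewrite rmorph_prod prodrXz => [|i]; last by rewrite !U.
  apply: eq_bigr => i _; rewrite rmorphXz ?U //= exprz_exp -exprD addnC.
  by [].
pose h (p : 'I_n.+3 * 'I_n.+2) : 'I_n.+3 * 'I_n.+2 := (inord p.2, inord p.1.-1).
pose h' (p : 'I_n.+3 * 'I_n.+2) : 'I_n.+3 * 'I_n.+2 := (inord p.2.+1, inord p.1).
have h1 (p : 'I_n.+3 * 'I_n.+2) : (h p).1 = p.2 :> nat.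
  by rewrite /= inordK // leqW.
have h2 (p : 'I_n.+3 * 'I_n.+2) : (h p).2 = p.1.-1 :> nat.
  by rewrite /= inordK //; case: (p.1) => -[].
rewrite (bigID (fun p : 'I_n.+3 * 'I_n.+2 => (p.2 < p.1)%N)) /=.
rewrite [X in _ * X](reindex_onto h h') => [|[j i]]; last first.
  rewrite /= -leqNgt => le_ji; congr (_, _); apply/val_inj; rewrite /= !inordK //;
    first [exact: ltn_ord i | exact: leq_ltn_trans le_ji (ltn_ord i)].
rewrite [X in _ * X](eq_bigl (fun p : 'I_n.+3 * 'I_n.+2 => (p.2 < p.1)%N)).
  rewrite -big_split big1 // => -[j i] /= lt_ij.
  have ->: F (h (j, i)) = (F (j, i))^-1.
    rewrite /F h1 h2 /= /coface !gmap_comp.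
    rewrite (eq_gmap (face_face (j := j) (i := i) _ (h2 (j, i)) (h1 (j, i)))) //.
    rewrite -!gmap_comp -exprN1 exprz_exp; congr (_ ^ _).
    by rewrite -(ltn_predK lt_ij) /= addSn exprS mulrN1 mulN1r opprK addnC.
  by rewrite mulrV // UF.
case=> j i; rewrite h1 h2 -leqNgt /=.
have h'1 : (h' (h (j, i))).1 = j.-1.+1 :> nat.
  by rewrite [LHS]inordK ?h2 //=; case: (j : nat) (ltn_ord j) => // -[].
have h'2 : (h' (h (j, i))).2 = i :> nat by rewrite [LHS]inordK ?h1.
have [lt_ij|le_ji] := ltnP i j.
  rewrite -ltnS (ltn_predK lt_ij) lt_ij [h' _]surjective_pairing /=.
  by apply/eqP; congr (_, _); apply/val_inj; rewrite /= (h'1, h'2) ?(ltn_predK lt_ij).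
apply/negbTE/andP => -[le_ij /eqP e]; move: h'1; rewrite e /= => ej.
by move: (leq_trans le_ji le_ij); rewrite {1}ej ltnn.
Qed.

Definition cocycles n : set (twist_alg n) :=
  [set x | x \is a GRing.unit /\ twist_diff x = 1].

Definition coboundaries n : set (twist_alg n) :=
  match n with
  | 0 => [set 1]
  | m.+1 => [set twist_diff y | y in [set y : twist_alg m | y \is a GRing.unit]]
  end.

Lemma coboundary_cocycle n : @coboundaries n `<=` @cocycles n.
Proof.
case: n => [_ ->|n _ [y Uy <-]]; last first.
  by split; [apply: twist_diff_unit | apply: twist_diffK].
split; first exact: unitr1.
by rewrite /twist_diff big1 // => i _; rewrite rmorph1 exp1rz.
Qed.

(* H^n, as the set of cosets in the group of cocycles of the subgroup of
   coboundaries. *)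
Definition twist_cohomology n : set (set (twist_alg n)) :=
  [set [set x * b | b in @coboundaries n] | x in @cocycles n].

End TwistComplex.

Arguments cocycles : clear implicits.
Arguments coboundaries : clear implicits.
Arguments twist_cohomology : clear implicits.

(* Main.v *)
From HB Require Import structures.
Require Import Defs.
From mathcomp Require Import all_boot all_order all_algebra.
From mathcomp Require Import classical_sets.
From mathcomp Require Import zify.

Set Implicit Arguments.
Unset Strict Implicit.
Unset Printing Implicit Defensive.

Import GRing.Theory.
Local Open Scope ring_scope.
Local Open Scope classical_set_scope.

(** The idea is to linearise the unit group by a logarithm that commutes with
the cofaces.

Let E be an elementary abelian 2-group and k of characteristic 2.  Squaring
on k[E] is the square of the augmentation, so the units of augmentation 1
form a group of exponent 2.  For x = \sum_g x_g [g] let Q(x) be the sum of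
x_g x_h [g + h] over the unordered pairs of distinct elements g, h
([pair_sum]).  Formally Q(x) is half of x^2 - \sum_g x_g^2 [0], which makes
it quadratic with polar form x y - (x y)_0 [0]; expanding the square of a
product in the same way gives Q(x y) = aug(x)^2 Q(y) + aug(y)^2 Q(x)
([pair_sumM]).  So Q is a homomorphism from the units of augmentation 1 to
the additive group of k[E].  It commutes with k[f] for every injective f,
hence with the cofaces ([pair_sum_gmap]), and so maps the complex of
units of augmentation 1 to the additive complex (k[G^n], \sum_i d^i).

A character chi : E -> Z/2 gives the derivation x |-> \sum_(chi g) x_g over the
augmentation ([massM]).  On the units of augmentation 1 that all these
derivations kill, that is, on 1 + I^2 with I the augmentation ideal, Q is a
bijection, modulo constants, onto the elements that they all kill
([pair_sum_injective], [pair_sum_surjective]).  This leaves two linear computations.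

- The additive complex is contractible in positive degrees: restricting x to
  the tuples with first entry 0 is a contracting homotopy
  ([add_diff_contract]).  It is the Hochschild complex of a diagonalizable
  group scheme with additive coefficients.
- The derivations attached to the coordinates of G^n identify I / I^2 with
  tuples (v_0, .., v_(n-1)) of vectors over k, with cofaces that insert a 0 at
  an end or double an entry.  This complex is acyclic in degrees at least 2
  ([face_sum_prim]).

Now let u be an n-cocycle, n >= 3.  Scalars are split off directly.  Because
n >= 2 the derivations of u can be made 0 by a coboundary
([cocycle_aug1]).  Then Q(u) is an additive cocycle, Q(u) = d y with y of degree
n - 1.  A derivation with value v on u has the value v + v^2 on Q(u)
([mass_pair_sum]), so Q(u) has derivations 0 and those of y form a cocycle;
because n - 1 >= 2, adding an additive coboundary to y makes them 0.  So
y = Q(w) modulo constants, and Q(u d(w)) is constant, whence u = d(w)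
([cocycle_coord0]).  The bound n >= 3 is used only for n - 1 >= 2. *)

(** * Partial sums of coefficients *)

Section Mass.
Variables (k : comNzRingType) (E : finZmodType).
Implicit Types (x y : galg k E) (g h : E) (S : pred E).

Lemma galgE x : x = \sum_g x g *: gbase k g.
Proof.
apply/ffunP => h; rewrite sum_ffunE (bigD1 h) //= big1 ?addr0 => [|g gh].
  by rewrite !ffunE eqxx; rewrite /GRing.scale /= mulr1.
by rewrite !ffunE eq_sym (negPf gh) /GRing.scale /= mulr0.
Qed.

Lemma gbaseM g h : gbase k g * gbase k h = gbase k (g + h).
Proof.
apply/ffunP => s; rewrite ffunE (bigD1 g) //= big1 ?addr0 => [|i ig].
  by rewrite !ffunE eqxx mul1r subr_eq addrC.
by rewrite ffunE (negPf ig) mul0r.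
Qed.

Lemma scaler_ffunE (a : k) x g : (a *: x) g = a * x g.
Proof. by rewrite ffunE. Qed.

Definition coef_id x : k := x 0.

Lemma coef_idZ a x : coef_id (a *: x) = a * coef_id x.
Proof. exact: scaler_ffunE. Qed.

(** A quadratic map is determined by its polar form and its values on the
multiples of group elements; the identities for pair sums below are all
obtained in this way. *)
Lemma eq_quadratic (V : nmodType) (B : galg k E -> galg k E -> V)
    (F F' : galg k E -> V) :
    (forall x y, F (x + y) = F x + F y + B x y) ->
    (forall x y, F' (x + y) = F' x + F' y + B x y) ->
    (forall a g, F (a *: gbase k g) = F' (a *: gbase k g)) -> F =1 F'.
Proof.
move=> FD F'D eqF x; have eqF0 : F 0 = F' 0 by rewrite -(scale0r (gbase k 0)) eqF.
rewrite [x]galgE; elim/big_rec: _ => // g y _ IHy.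
by rewrite FD F'D eqF IHy.
Qed.

Lemma eq_additive (V : nmodType) (F F' : galg k E -> V) :
    {morph F : x y / x + y} -> {morph F' : x y / x + y} ->
    (forall a g, F (a *: gbase k g) = F' (a *: gbase k g)) -> F =1 F'.
Proof.
by move=> FD F'D; apply: (@eq_quadratic _ (fun _ _ => 0)) => x y; rewrite addr0.
Qed.

(** With S the whole group this is the augmentation, and with S the support of
a character E -> Z/2 it is a derivation over the augmentation. *)
Definition mass S x : k := \sum_(g | S g) x g.

Fact mass_is_nmod_morphism S : nmod_morphism (mass S).
Proof.
split=> [|x y]; first by rewrite /mass big1 // => g _; rewrite ffunE.
by rewrite /mass -big_split; apply: eq_bigr => g _; rewrite ffunE.
Qed.

HB.instance Definition _ S :=
  GRing.isNmodMorphism.Build (galg k E) k (mass S) (mass_is_nmod_morphism S).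

Lemma massZ S a x : mass S (a *: x) = a * mass S x.
Proof. by rewrite /mass mulr_sumr; apply: eq_bigr => g _; rewrite scaler_ffunE. Qed.

Lemma mass_gbase S g : mass S (gbase k g) = (S g)%:R.
Proof.
rewrite /mass big_mkcond (bigD1 g) //= ffunE eqxx big1 ?addr0 => [|h hg].
  by case: (S g).
by rewrite ffunE (negPf hg) if_same.
Qed.

Lemma eq_mass S S' x : S =1 S' -> mass S x = mass S' x.
Proof. by move=> eqS; apply: eq_bigl. Qed.

End Mass.

Notation aug := (mass predT).

Lemma mass_gmap (k : comNzRingType) (E F : finZmodType) (f : E -> F) (S : pred F)
    (x : galg k E) : mass S (gmap f x) = mass (S \o f) x.
Proof.
rewrite /mass [RHS](partition_big f S) //=; apply: eq_bigr => h Sh.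
rewrite ffunE; apply: eq_bigl => g /=.
by case: eqVneq => [->|]; rewrite ?andbF ?Sh.
Qed.

(** * The logarithm on an elementary abelian 2-group *)

Section Char2.
Variables (k : comNzRingType) (E : finZmodType).
Hypothesis char2 : 2%N \in [pchar k].
Hypothesis E2 : forall g : E, g + g = 0.
Implicit Types (x y : galg k E) (g h : E).

Lemma galg_pchar2 : 2%N \in [pchar galg k E].
Proof.
apply/andP; split=> //; apply/eqP/ffunP => g.
by rewrite mulr2n !ffunE (addrr_pchar2 char2).
Qed.

Lemma augM x y : aug (x * y) = aug x * aug y.
Proof.
move: x; apply: eq_additive => [x x'|x x'|a g].
- by rewrite mulrDl raddfD.
- by rewrite raddfD mulrDl.
move: y; apply: eq_additive => [y y'|y y'|b h].
- by rewrite mulrDr raddfD.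
- by rewrite raddfD mulrDr.
by rewrite -scalerAl -scalerAr gbaseM !massZ !mass_gbase /= !mulr1.
Qed.

Lemma aug1 : aug (1 : galg k E) = 1.
Proof. by rewrite mass_gbase. Qed.

(** An additive map chi : E -> Z/2 extends to a derivation k[E] -> k over the
augmentation; this is checked on group elements. *)
Lemma massM (chi : pred E) x y :
    (forall g h, chi (g + h) = chi g (+) chi h) ->
  mass chi (x * y) = aug x * mass chi y + aug y * mass chi x.
Proof.
move=> chiD; move: x; apply: eq_additive => [x x'|x x'|a g].
- by rewrite mulrDl raddfD.
- by rewrite !raddfD /= mulrDl mulrDr addrACA.
move: y; apply: eq_additive => [y y'|y y'|b h].
- by rewrite mulrDr raddfD.
- by rewrite !raddfD /= mulrDl mulrDr addrACA.
rewrite -scalerAl -scalerAr gbaseM !massZ !mass_gbase /= !mulr1 chiD.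
rewrite [b * (a * _)]mulrCA -!mulrDr; do 2!congr (_ * _).
case: (chi g); case: (chi h); rewrite /= ?addr0 ?add0r //.
by rewrite addrr_pchar2.
Qed.

(** Frobenius kills the group: [g] ^+ 2 = [g + g] = 1. *)
Lemma sqr_aug x : x ^+ 2 = (aug x ^+ 2)%:A.
Proof.
move: x; apply: eq_additive => [x y|x y|a g].
- by rewrite sqrrD (mulrn_pchar galg_pchar2) addr0.
- by rewrite raddfD /= sqrrD (mulrn_pchar char2) addr0 scalerDl.
by rewrite exprZn [gbase k g ^+ 2]expr2 gbaseM E2 massZ mass_gbase mulr1.
Qed.

Lemma aug1_sqr x : aug x = 1 -> x * x = 1.
Proof. by rewrite -expr2 sqr_aug => ->; rewrite expr1n scale1r. Qed.

Lemma aug1_unit x : aug x = 1 -> x \is a GRing.unit.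
Proof. by move=> /aug1_sqr xx; apply/unitrPr; exists x. Qed.

Lemma aug1_inv x : aug x = 1 -> x^-1 = x.
Proof.
move=> x1; apply: (mulrI (aug1_unit x1)).
by rewrite mulrV ?aug1_unit // aug1_sqr.
Qed.

(** The enumeration of E serves only to count each unordered pair
{g, s - g} once. *)
Definition pair_sum x : galg k E :=
  [ffun s => \sum_(g | (enum_rank g < enum_rank (s - g)%R)%N) x g * x (s - g)].

(** Of the mixed terms of the expansion, one has the smaller index on x and
the other on y; together they run over all ordered pairs of distinct
elements. *)
Lemma pair_sum_polar x y s :
  pair_sum (x + y) s =
    pair_sum x s + pair_sum y s + \sum_(g | g != s - g) x g * y (s - g).
Proof.
pose lt g := (enum_rank g < enum_rank (s - g)%R)%N.
rewrite [X in _ = _ + X](bigID lt) /=.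
rewrite [X in _ = _ + (_ + X)](reindex_inj (inj_comp (addrI s) (@oppr_inj _))) /=.
rewrite [X in _ = _ + (X + _)](eq_bigl lt); last first.
  by rewrite /lt => g; case: eqVneq => [<-|]; rewrite /= ?ltnn ?andbT.
rewrite [X in _ = _ + (_ + X)](eq_bigl lt); last first.
  rewrite /lt => g; rewrite subKr -leqNgt eq_sym leq_eqVlt.
  case: (eqVneq g (s - g)) => [<-|ne] /=; first by rewrite ltnn.
  by case: eqP => //= /val_inj/enum_rank_inj e; case/eqP: ne.
rewrite !ffunE -!big_split; apply: eq_bigr => g _ /=.
rewrite !ffunE subKr mulrDl !mulrDr -!addrA; congr (_ + _).
by rewrite [y g * x _ + _]addrC addrCA [y g * x _]mulrC.
Qed.

(** The terms with g = s - g that the polar form leaves out occur only for s = 0,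
because g + g = 0, and there they are all the terms. *)
Lemma pair_sumD x y :
  pair_sum (x + y) = pair_sum x + pair_sum y + x * y + (coef_id (x * y))%:A.
Proof.
apply/ffunP => s; rewrite pair_sum_polar !(ffunE (fun _ => _ + _)) -!addrA.
do 2!congr (_ + _); rewrite scaler_ffunE /coef_id !ffunE.
have [->|s0] := eqVneq s 0.
  rewrite big1 => [|g]; first by rewrite mulr1 (addrr_pchar2 char2).
  by rewrite sub0r -addr_eq0 E2 eqxx.
rewrite mulr0 addr0; apply: eq_bigl => g.
by apply/eqP => e; case/eqP: s0; rewrite -(subrK g s) -e E2.
Qed.

Lemma pair_sum_gbase a g : pair_sum (a *: gbase k g) = 0.
Proof.
apply/ffunP => s; rewrite !ffunE big1 // => h; rewrite !scaler_ffunE !ffunE.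
have [->|] := eqVneq h g; last by rewrite mulr0 mul0r.
have [->|] := eqVneq (s - g) g; first by rewrite ltnn.
by rewrite !mulr0.
Qed.

Lemma pair_sum1 : pair_sum 1 = 0.
Proof. by rewrite -[1]scale1r pair_sum_gbase. Qed.

(** Both sides are quadratic in each factor with the same polar form, because
(x y) (x y') = aug(x)^2 y y'. *)
Lemma pair_sumM x y :
  pair_sum (x * y) = aug x ^+ 2 *: pair_sum y + aug y ^+ 2 *: pair_sum x.
Proof.
move: y; apply: (@eq_quadratic _ _ _ (fun y y' =>
  aug x ^+ 2 *: (y * y') + aug x ^+ 2 *: (coef_id (y * y'))%:A)) => [y y'|y y'|a g].
- rewrite mulrDr pair_sumD -!addrA; do 2!congr (_ + _).
  by rewrite mulrACA -expr2 sqr_aug mulr_algl coef_idZ scalerA.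
- rewrite raddfD /= sqrrD (mulrn_pchar char2) addr0 pair_sumD !scalerDr scalerDl.
  rewrite [X in _ = X + _]addrACA -[_ + _ *: (y * y') + _]addrA.
  exact: addrAC.
rewrite pair_sum_gbase scaler0 add0r massZ mass_gbase mulr1.
move: x; apply: (@eq_quadratic _ _ _ (fun x x' =>
  a ^+ 2 *: (x * x') + a ^+ 2 *: (coef_id (x * x'))%:A)) => [x x'|x x'|b h].
- rewrite mulrDl pair_sumD -!addrA; do 2!congr (_ + _).
  rewrite mulrACA -expr2 [(a *: _) ^+ 2]sqr_aug massZ mass_gbase mulr1 mulrC.
  by rewrite mulr_algl coef_idZ scalerA.
- by rewrite pair_sumD !scalerDr -!addrA.
by rewrite -scalerAl -scalerAr gbaseM scalerA !pair_sum_gbase scaler0.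
Qed.

Lemma pair_sumM1 x y : aug x = 1 -> aug y = 1 ->
  pair_sum (x * y) = pair_sum x + pair_sum y.
Proof. by move=> x1 y1; rewrite pair_sumM x1 y1 expr1n !scale1r addrC. Qed.

Section Character.
Variable chi : pred E.
Hypothesis chiD : forall g h, chi (g + h) = chi g (+) chi h.

Lemma char0 : chi 0 = false.
Proof. by have := chiD 0 0; rewrite addr0 addbb. Qed.

Lemma charB g h : chi (g - h) = chi g (+) chi h.
Proof. by rewrite -{2}(subrK h g) [chi (_ + h)]chiD -addbA addbb addbF. Qed.

Lemma mass_char_alg a : mass chi (a%:A : galg k E) = 0.
Proof. by rewrite massZ mass_gbase char0 mulr0. Qed.

(** The pairs {g, h} that contribute are those with exactly one of chi g and
chi h true, so the left-hand side is the product of the two partial sums of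
x, and these are mass chi x and aug x - mass chi x. *)
Lemma mass_pair_sum x : mass chi (pair_sum x) = aug x * mass chi x + mass chi x ^+ 2.
Proof.
move: x; apply: (@eq_quadratic _ _ _ (fun x y =>
  aug x * mass chi y + aug y * mass chi x)) => [x y|x y|a g].
- by rewrite pair_sumD !raddfD /= mass_char_alg addr0 massM.
- rewrite !raddfD /= sqrrD (mulrn_pchar char2) addr0 mulrDl !mulrDr.
  rewrite [aug y * mass chi x + _]addrC.
  rewrite [_ + (_ + aug y * mass chi x)]addrACA [LHS]addrAC.
  by congr (_ + _); rewrite addrACA.
rewrite pair_sum_gbase raddf0 !massZ !mass_gbase mulr1; case: (chi g) => /=.
  by rewrite mulr1 -expr2 addrr_pchar2.
by rewrite mulr0 expr0n mulr0 addr0.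
Qed.

(** Write u = a + b with b the part of u on the support of chi.  On that support
pair_sum u equals a * b, so a * b = 0; and a has augmentation 1, hence is
invertible. *)
Lemma pair_sum_eq0_supp u : aug u = 1 -> mass chi u = 0 ->
  (forall s, chi s -> pair_sum u s = 0) -> forall s, chi s -> u s = 0.
Proof.
move=> u1 chiu qu.
pose a : galg k E := [ffun g => if chi g then 0 else u g].
pose b : galg k E := [ffun g => if chi g then u g else 0].
have def_u : u = a + b.
  by apply/ffunP => g; rewrite !ffunE; case: ifP; rewrite ?add0r ?addr0.
have a1 : aug a = 1.
  rewrite -u1 /mass [RHS](bigID chi) /= -/(mass chi u) chiu add0r.
  rewrite [RHS]big_mkcond; apply: eq_bigr => g _; rewrite ffunE.
  by case: (chi g).
have ab0 : a * b = 0.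
  apply/ffunP => s; rewrite [RHS]ffunE; have [chis|nchis] := boolP (chi s); last first.
    rewrite ffunE big1 // => g _; rewrite !ffunE charB (negPf nchis) /=.
    by case: (chi g); rewrite ?mul0r ?mulr0.
  have := qu s chis; rewrite def_u pair_sumD !(ffunE (fun _ => _ + _)) scaler_ffunE.
  have /negPf s0 : s != 0 by apply: contraTneq chis => ->; rewrite char0.
  rewrite [(1 : galg k E) s]ffunE s0 mulr0 addr0.
  rewrite [pair_sum a s]ffunE [pair_sum b s]ffunE.
  rewrite !big1 ?add0r // => g _; rewrite !ffunE charB chis /=;
    by case: (chi g); rewrite /= ?mul0r ?mulr0.
have b0 : b = 0 by rewrite -[b]mul1r -(aug1_sqr a1) -mulrA ab0 mulr0.
by move=> s chis; have /ffunP/(_ s) := b0; rewrite !ffunE chis.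
Qed.

End Character.

Section Coordinates.
Variables (I : finType) (e : I -> E) (chi : I -> pred E).
Hypothesis chiD : forall i g h, chi i (g + h) = chi i g (+) chi i h.
Hypothesis chiE : forall g, g = \sum_i (if chi i g then e i else 0).

Lemma pair_sum_injective u : aug u = 1 -> (forall i, mass (chi i) u = 0) ->
  (forall s, s != 0 -> pair_sum u s = 0) -> u = 1.
Proof.
move=> u1 chiu qu.
have u0 g : g != 0 -> u g = 0.
  move=> g0; have [i chig|nchi] := pickP (fun i => chi i g).
    apply: (pair_sum_eq0_supp (chiD i)) => // s chis; apply: qu.
    by apply: contraTneq chis => ->; rewrite (char0 (chiD i)).
  by case/eqP: g0; rewrite [LHS]chiE big1 // => i _; rewrite nchi.
apply/ffunP => g; rewrite ffunE; have [->|/u0 -> //] := eqVneq g 0.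
by rewrite -u1 /mass (bigD1 0) //= big1 ?addr0.
Qed.

(** The values of the logarithm, up to constants, on the subgroup of
pair_sum_injective. *)
Let log_image y := exists w, [/\ aug w = 1, forall i, mass (chi i) w = 0
  & exists c, pair_sum w = y + c%:A].

Let log_imageD y y' : log_image y -> log_image y' -> log_image (y + y').
Proof.
move=> [w [w1 chiw [c qw]]] [w' [w'1 chiw' [c' qw']]]; exists (w * w'); split.
- by rewrite augM w1 w'1 mulr1.
- by move=> i; rewrite massM // chiw chiw' !mulr0 addr0.
by exists (c + c'); rewrite pair_sumM1 // qw qw' scalerDl addrACA.
Qed.

Let log_image_alg c : log_image c%:A.
Proof.
exists 1; split; first exact: aug1.
  by move=> i; rewrite mass_gbase (char0 (chiD i)).
by exists c; rewrite pair_sum1 (addrr_pchar2 galg_pchar2).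
Qed.

(** The element 1 + a (1 + [g]) (1 + [h]) has this logarithm: the quadratic part
vanishes because pair_sum of a product of two elements of augmentation 0 is
0. *)
Let log_image_square a g h :
  log_image (a *: (gbase k g + gbase k h + gbase k (g + h))).
Proof.
pose x : galg k E := a *: ((1 + gbase k g) * (1 + gbase k h)).
have aug0 h' : aug (1 + gbase k h') = 0.
  by rewrite raddfD /= aug1 mass_gbase (addrr_pchar2 char2).
have x0 : aug x = 0 by rewrite massZ augM aug0 mul0r mulr0.
exists (1 + x); split; first by rewrite raddfD /= aug1 x0 addr0.
  move=> i; rewrite raddfD /= mass_gbase (char0 (chiD i)) add0r massZ massM //.
  by rewrite !aug0 !mul0r addr0 mulr0.
have qx : pair_sum x = 0.
  by rewrite /x scalerAl pair_sumM massZ !aug0 mulr0 expr0n !scale0r addr0.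
exists (a + coef_id (1 * x)).
rewrite pair_sumD pair_sum1 qx !add0r scalerDl mul1r addrA.
congr (_ + _); rewrite /x mulrDl !mulrDr !mul1r mulr1 gbaseM !scalerDr.
by rewrite [RHS]addrC -!addrA; congr (_ + _); rewrite addrCA.
Qed.

(** By log_image_square, g |-> a [g] is additive modulo log_image, so it is
determined by the coordinates of g. *)
Let log_image_coord a g :
  log_image (a *: (gbase k g + \sum_i (chi i g)%:R *: gbase k (e i))).
Proof.
pose f i := if chi i g then e i else 0.
have -> : gbase k g = gbase k (\sum_i f i) by rewrite -chiE.
elim/big_rec2: _ => [|i x h _ IH].
  by rewrite addr0; apply: log_image_alg.
rewrite /f; case: (chi i g); last by rewrite add0r scale0r add0r.
have := log_imageD (log_image_square a (e i) h) IH; congr log_image.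
rewrite -scalerDr scale1r; congr (_ *: _).
rewrite [gbase k (e i) + _ + _]addrAC -[_ + gbase k h + _]addrA.
rewrite (addKr_pchar2 galg_pchar2).
by rewrite [gbase k (e i) + _]addrC addrA.
Qed.

Lemma pair_sum_surjective y : (forall i, mass (chi i) y = 0) ->
  exists w, [/\ aug w = 1, forall i, mass (chi i) w = 0
  & exists c, pair_sum w = y + c%:A].
Proof.
move=> chiy; rewrite -/(log_image y).
have -> : y = \sum_g y g *: (gbase k g + \sum_i (chi i g)%:R *: gbase k (e i)).
  under eq_bigr do rewrite scalerDr.
  rewrite big_split /= -galgE -[LHS]addr0; congr (_ + _); symmetry.
  under eq_bigr do rewrite scaler_sumr.
  rewrite exchange_big big1 //= => i _.
  under eq_bigr do rewrite scalerA.
  rewrite -scaler_suml -(scale0r (gbase k (e i))); congr (_ *: _).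
  rewrite -[RHS](chiy i) /mass [RHS]big_mkcond; apply: eq_bigr => g _.
  by case: (chi i g); rewrite ?mulr1 ?mulr0.
elim/big_rec: _ => [|g x _ IH].
  by rewrite -(scale0r 1); apply: log_image_alg.
exact: log_imageD (log_image_coord _ _) IH.
Qed.

End Coordinates.
End Char2.

(** Injectivity of f is essential: a pair that f collapses would be lost. *)
Lemma pair_sum_gmap (k : comNzRingType) (E F : finZmodType) (f : {additive E -> F})
    (x : galg k E) :
    2%N \in [pchar k] -> (forall g : E, g + g = 0) -> (forall g : F, g + g = 0) ->
  injective f -> gmap f (pair_sum x) = pair_sum (gmap f x).
Proof.
move=> char2 E2 F2 f_inj.
have gmap0 (z : galg k E) : coef_id (gmap f z) = coef_id z.
  rewrite /coef_id ffunE (big_pred1 0) // => g /=.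
  by rewrite -(inj_eq f_inj) raddf0.
move: x; apply: (@eq_quadratic _ _ _ (fun x y =>
  gmap f (x * y) + (coef_id (x * y))%:A)) => [x y|x y|a g].
- by rewrite pair_sumD // !raddfD /= linearZ rmorph1 -!addrA.
- by rewrite raddfD pair_sumD //= -rmorphM gmap0 -!addrA.
by rewrite linearZ /= gmap_gbase !pair_sum_gbase raddf0.
Qed.

(** * The complex of coordinates *)

Section FaceSums.
Variable k : comNzRingType.
Hypothesis char2 : 2%N \in [pchar k].

Lemma mulrn_odd (a : k) m : a *+ m = if odd m then a else 0.
Proof.
rewrite -{1}[m]odd_double_half mulrnDr -muln2 mulrnA (mulrn_pchar char2) addr0.
by case: (odd m).
Qed.

(** The entry p of the alternating sum of the cofaces of the sequence v; signs
are irrelevant in characteristic 2. *)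
Definition face_sum n (v : nat -> k) p : k :=
  \sum_(i < n.+2) (if (p < i)%N then v p else if p == 0 then 0 else v p.-1).

Lemma face_sumE n v p : (p <= n.+1)%N ->
  face_sum n v p = (if odd p || (p == 0) then 0 else v p.-1) +
                   (if odd (n.+1 - p) then v p else 0).
Proof.
move=> le_pn; rewrite /face_sum.
rewrite -(big_mkord predT
  (fun i => if (p < i)%N then v p else if p == 0 then 0 else v p.-1)).
rewrite (@big_cat_nat _ _ _ p.+1) //=; congr (_ + _).
  rewrite (eq_big_nat _ _ (F2 := fun=> if p == 0 then 0 else v p.-1)); last first.
    move=> i; rewrite ltnS => /andP[_].
    by rewrite leqNgt => /negPf ->.
  by rewrite sumr_const_nat mulrn_odd /=; case: (p) => // q /=; case: odd.
rewrite (eq_big_nat _ _ (F2 := fun=> v p)) => [|i /andP[-> _] //].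
by rewrite sumr_const_nat mulrn_odd subSS.
Qed.

Lemma eq_face_sum n v v' p : v =1 v' -> face_sum n v p = face_sum n v' p.
Proof. by move=> eqv; apply: eq_bigr => i _; rewrite !eqv. Qed.

(** A primitive of a cocycle of degree m.+2.  For even m a cocycle satisfies
v_0 = 0, v_1 = v_2, v_3 = v_4, .., v_(m+1) = 0, and its odd entries form a
primitive.  For odd m the odd entries of a cocycle vanish, and of its even
entries the last one is moved to the odd position m, where the differential
copies it to position m + 1 only. *)
Definition face_prim m (v : nat -> k) p : k :=
  if odd m then
    if p == m then v m.+1 else if ~~ odd p && (p < m)%N then v p else 0
  else if odd p then v p else 0.

Section Acyclic.
Variables (m : nat) (v : nat -> k).
Hypothesis v_supp : forall p, (m.+2 <= p)%N -> v p = 0.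
Hypothesis v_cocycle : forall p, face_sum m.+2 v p = 0.

Lemma face_prim_supp p : (m.+1 <= p)%N -> face_prim m v p = 0.
Proof.
move=> lt_mp; rewrite /face_prim; case: ifP => odd_m.
  by rewrite gtn_eqF // ltnNge (ltnW lt_mp) andbF.
case: ifP => // odd_p; move: lt_mp; rewrite leq_eqVlt => /predU1P[<-|/v_supp //].
have := v_cocycle m.+2; rewrite face_sumE //= odd_m [v m.+2]v_supp //.
by rewrite if_same addr0.
Qed.

Lemma face_sum_prim p : face_sum m.+1 (face_prim m v) p = v p.
Proof.
have [le_pm|lt_mp] := leqP p m.+2; last first.
  rewrite v_supp ?(ltnW lt_mp) // /face_sum big1 // => i _.
  rewrite !face_prim_supp ?if_same //; lia.
have := v_cocycle p; rewrite !face_sumE ?(leqW le_pm) //.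
rewrite subSn //= oddB //= negbK /face_prim.
have [odd_p|even_p] /= := boolP (odd p); have [odd_m|even_m] /= := boolP (odd m).
- by rewrite !add0r.
- by rewrite !add0r.
- move=> _; case: p even_p le_pm => [|q] /= odd_q le_qm.
    by rewrite add0r; case: (m) odd_m.
  have /negPf -> : q.+1 != m by apply: contraTneq odd_m => <-.
  have [->|ne_qm] := eqVneq q m; first by rewrite ltnNge leqnSn addr0.
  rewrite negbK in odd_q; rewrite odd_q add0r /=; case: ltnP => // le_mq.
  by exfalso; lia.
- case: p even_p {le_pm} => [|q] /=; first by rewrite !add0r => _ ->.
  rewrite negbK addr0 => -> /eqP; rewrite addr_eq0 => /eqP ->.
  by rewrite oppr_pchar2.
Qed.

End Acyclic.
End FaceSums.

(** * The additive and the multiplicative complexes *)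

Section Cofaces.
Variables (k : comNzRingType) (G : finZmodType).
Hypothesis char2 : 2%N \in [pchar k].
Hypothesis G2 : forall g : G, g + g = 0.
Local Notation A := (twist_alg k G).

Lemma addgg_ffun n (g : {ffun 'I_n -> G}) : g + g = 0.
Proof. by apply/ffunP => i; rewrite !ffunE. Qed.

Lemma size_fgraph_ord n (g : {ffun 'I_n -> G}) : size (fgraph g) = n.
Proof. by rewrite size_tuple card_ord. Qed.

Lemma face_inj n (i : 'I_n.+2) : injective (@face G n i).
Proof.
move=> g h eq_gh; apply/ffunP => p; rewrite -!(nth_fgraph_ord 0 p).
have nth_eq q : nth 0 (fgraph (face i g)) q = nth 0 (fgraph (face i h)) q.
  by rewrite eq_gh.
have [lt_pi|le_ip] := ltnP p i.
  by have := nth_eq p; rewrite !nth_face lt_pi.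
by have := nth_eq p.+1; rewrite !nth_face ltnNge (leqW le_ip).
Qed.

Lemma aug_coface n (i : 'I_n.+2) (x : A n) : aug (coface i x) = aug x.
Proof. exact: mass_gmap. Qed.

Lemma pair_sum_coface n (i : 'I_n.+2) (x : A n) :
  coface i (pair_sum x) = pair_sum (coface i x).
Proof.
by apply: pair_sum_gmap => //; [exact: addgg_ffun|exact: addgg_ffun|exact: face_inj].
Qed.

Section Products.
Variables (n : nat) (I : Type) (F : I -> A n).
Hypothesis F1 : forall i, aug (F i) = 1.

Lemma aug_prod1 (r : seq I) : aug (\prod_(i <- r) F i) = 1.
Proof.
elim: r => [|i r IHr]; first by rewrite big_nil aug1.
by rewrite big_cons augM F1 IHr mulr1.
Qed.

Lemma pair_sum_prod (r : seq I) :
  pair_sum (\prod_(i <- r) F i) = \sum_(i <- r) pair_sum (F i).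
Proof.
elim: r => [|i r IHr]; first by rewrite !big_nil pair_sum1.
by rewrite !big_cons pair_sumM1 ?aug_prod1 ?IHr //; apply: addgg_ffun.
Qed.

Lemma mass_prod (chi : pred {ffun 'I_n -> G}) (r : seq I) :
    (forall g h, chi (g + h) = chi g (+) chi h) ->
  mass chi (\prod_(i <- r) F i) = \sum_(i <- r) mass chi (F i).
Proof.
move=> chiD; elim: r => [|i r IHr].
  by rewrite !big_nil mass_gbase (char0 chiD).
by rewrite !big_cons massM // F1 aug_prod1 !mul1r IHr addrC.
Qed.

End Products.

Lemma twist_diff_aug1 n (x : A n) : aug x = 1 ->
  twist_diff x = \prod_(i < n.+2) coface i x.
Proof.
move=> x1; apply: eq_bigr => i _; have xi1 := etrans (aug_coface i x) x1.
rewrite -signr_odd; case: (odd i).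
  by rewrite expr1 exprN1 (aug1_inv char2 (@addgg_ffun _)).
by rewrite expr0 expr1z.
Qed.

Lemma aug_twist_diff n (x : A n) : aug x = 1 -> aug (twist_diff x) = 1.
Proof.
by move=> x1; rewrite twist_diff_aug1 // aug_prod1 // => i; rewrite aug_coface.
Qed.

Definition add_diff n (x : A n) : A n.+1 := \sum_(i < n.+2) coface i x.

Lemma add_diffD n (x y : A n) : add_diff (x + y) = add_diff x + add_diff y.
Proof. by rewrite -big_split; apply: eq_bigr => i _; rewrite raddfD. Qed.

Lemma pair_sum_twist_diff n (x : A n) : aug x = 1 ->
  pair_sum (twist_diff x) = add_diff (pair_sum x).
Proof.
move=> x1; rewrite twist_diff_aug1 // pair_sum_prod => [|i]; last by rewrite aug_coface.
by apply: eq_bigr => i _; rewrite pair_sum_coface.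
Qed.

(** Simplicial cancellation in characteristic 2: the row added to the square
array is equal to the column added. *)
Lemma sum_cancel (V : nmodType) (F : nat -> nat -> V) n :
    (forall x : V, x + x = 0) ->
    (forall j i, (i < j)%N -> (j <= n)%N -> F j i = F i j.-1) ->
  \sum_(j < n.+1) \sum_(i < n) F j i = 0.
Proof.
move=> V2; elim: n => [|n IHn] FE; first by rewrite big1 // => j _; rewrite big_ord0.
rewrite big_ord_recr /=; under eq_bigr do rewrite big_ord_recr /=.
rewrite big_split /= IHn => [|j i lt_ij le_jn]; last by rewrite FE // leqW.
rewrite add0r [X in _ + X](eq_bigr (fun i : 'I_n.+1 => F i n)) ?V2 // => i _.
by rewrite FE.
Qed.

Lemma add_diffK n (x : A n) : add_diff (add_diff x) = 0.
Proof.
pose F j i := gmap (face (inord j : 'I_n.+3) \o face (inord i : 'I_n.+2)) x.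
rewrite -[RHS](@sum_cancel (A n.+2) F n.+2) => [|y|j i lt_ij le_jn].
- apply: eq_bigr => j _; rewrite raddf_sum; apply: eq_bigr => i _.
  by rewrite /F !inord_val -gmap_comp.
- exact: (addrr_pchar2 (galg_pchar2 _ char2)).
apply: eq_gmap; apply: face_face; rewrite !inordK //; lia.
Qed.

(** A contracting homotopy of the additive complex: a retraction of the coface
0 that intertwines the cofaces i + 1 and i. *)
Definition contract n (x : A n.+1) : A n := [ffun h => x (face ord0 h)].

Fact contract_is_nmod_morphism n : nmod_morphism (@contract n).
Proof. by split=> [|x y]; apply/ffunP => h; rewrite !ffunE. Qed.

HB.instance Definition _ n :=
  GRing.isNmodMorphism.Build (A n.+1) (A n) (@contract n)
    (contract_is_nmod_morphism n).

Lemma contract_coface0 n (x : A n) : contract (coface ord0 x) = x.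
Proof.
apply/ffunP => h; rewrite !ffunE (big_pred1 h) // => g /=.
exact: inj_eq (@face_inj _ _) _ _.
Qed.

(** The tuples g with face (i + 1) g = face 0 h have first entry 0, that is, they
have the form face 0 g', and then face i g' = h. *)
Lemma contract_coface n (i : 'I_n.+2) (x : A n.+1) :
  contract (coface (lift ord0 i) x) = coface i (contract x).
Proof.
apply/ffunP => h; rewrite !ffunE.
pose back (g : {ffun 'I_n.+1 -> G}) : {ffun 'I_n -> G} :=
  [ffun j => g (lift ord0 j)].
have faceK : cancel (@face G n ord0) back.
  move=> g; apply/ffunP => j; rewrite ffunE -[LHS](nth_fgraph_ord 0) nth_face /=.
  by rewrite nth_fgraph_ord.
rewrite (reindex_onto (face ord0) back) /=; last first.
  move=> g /eqP eq_g; apply/ffunP => j.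
  rewrite -[LHS](nth_fgraph_ord 0) nth_face /=; case: (unliftP ord0 j) => [j'|] ->.
    by rewrite /= nth_fgraph_ord ffunE.
  rewrite /=; have: nth 0 (fgraph (face (lift ord0 i) g)) 0 = 0.
    by rewrite eq_g nth_face.
  by rewrite nth_face /= => /esym; rewrite -(nth_fgraph_ord 0).
apply: eq_big => [g|g _]; last by rewrite ffunE.
rewrite faceK eqxx andbT.
have := @face_face G _ (lift ord0 i) ord0 i ord0 isT erefl erefl g.
by move=> /= ->; rewrite (inj_eq (@face_inj _ _)).
Qed.

Lemma add_diff_contract n (x : A n.+1) :
  add_diff x = 0 -> add_diff (contract x) = x.
Proof.
move=> /(congr1 (@contract _)).
rewrite raddf_sum raddf0 big_ord_recl /= contract_coface0.
under eq_bigr do rewrite contract_coface.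
move=> /eqP; rewrite addrC addr_eq0 /add_diff => /eqP ->.
by rewrite (oppr_pchar2 (galg_pchar2 _ char2)).
Qed.

(** All cofaces fix the scalars, so the n + 2 factors cancel in pairs. *)
Lemma twist_diff_alg n (c c' : k) : c * c' = 1 ->
  twist_diff (c%:A : A n) = if odd n then c%:A else 1.
Proof.
move=> cc'; have Uc p : (c%:A : A p) \is a GRing.unit.
  apply/unitrPr; exists c'%:A.
  by rewrite mulr_algl scalerA cc' scale1r.
rewrite /twist_diff.
rewrite (eq_bigr (fun i : 'I_n.+2 => (c%:A : A n.+1) ^ ((-1) ^+ i : int))).
  have E m : \prod_(i < m) (c%:A : A n.+1) ^ ((-1) ^+ i : int) =
      if odd m then c%:A else 1.
    elim: m => [|m IHm]; first by rewrite big_ord0.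
    rewrite big_ord_recr /= IHm -signr_odd; case: (odd m) => /=.
      by rewrite expr1 exprN1 mulrV ?Uc.
    by rewrite mul1r expr0 expr1z.
  by rewrite E /= negbK.
by move=> i _; rewrite linearZ rmorph1.
Qed.

End Cofaces.

Section Coordinates.
Variables (k : comNzRingType) (G : finZmodType).
Hypothesis char2 : 2%N \in [pchar k].
Variables (I : finType) (e : I -> G) (chi : I -> pred G).
Hypothesis G2 : forall g : G, g + g = 0.
Hypothesis chiD : forall c g h, chi c (g + h) = chi c g (+) chi c h.
Hypothesis chi_e : forall c d, chi c (e d) = (c == d).
Hypothesis chiE : forall g, g = \sum_c (if chi c g then e c else 0).
Local Notation A := (twist_alg k G).

(** The index p ranges over all natural numbers, with the default entry 0 from n
on, so that one formula gives the cofaces in coordinates in every degree. *)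
Definition entry_char n p c : pred {ffun 'I_n -> G} :=
  fun g => chi c (nth 0 (fgraph g) p).

Lemma entry_char_ord n (p : 'I_n) c g : entry_char p c g = chi c (g p).
Proof. by rewrite /entry_char nth_fgraph_ord. Qed.

Lemma entry_char_out n p c (g : {ffun 'I_n -> G}) : (n <= p)%N ->
  entry_char p c g = false.
Proof.
by move=> le_np; rewrite /entry_char nth_default ?size_fgraph_ord // (char0 (chiD c)).
Qed.

Lemma entry_charD n p c (g h : {ffun 'I_n -> G}) :
  entry_char p c (g + h) = entry_char p c g (+) entry_char p c h.
Proof.
have [lt_pn|le_np] := ltnP p n; last by rewrite !entry_char_out.
by rewrite !(entry_char_ord (Ordinal lt_pn)) ffunE chiD.
Qed.

Definition coord n (x : A n) p c : k := mass (entry_char p c) x.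

Lemma coord_out n (x : A n) p c : (n <= p)%N -> coord x p c = 0.
Proof. by move=> le_np; apply: big_pred0 => g; apply: entry_char_out. Qed.

Lemma coord_coface n (i : 'I_n.+2) (x : A n) p c :
  coord (coface i x) p c =
    if (p < i)%N then coord x p c else if p == 0 then 0 else coord x p.-1 c.
Proof.
rewrite /coord [LHS]mass_gmap.
have E g : (entry_char p c \o face i) g = chi c (nth 0 (fgraph (face i g)) p) by [].
case: ifP => [lt_pi|le_ip].
  by apply: eq_mass => g; rewrite E nth_face lt_pi.
case: ifP => p0; last by apply: eq_mass => g; rewrite E nth_face le_ip p0.
by apply: big_pred0 => g; rewrite E nth_face le_ip p0 (char0 (chiD c)).
Qed.

Lemma coord_add_diff n (x : A n) p c :
  coord (add_diff x) p c = face_sum n (coord x ^~ c) p.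
Proof. by rewrite /coord raddf_sum; apply: eq_bigr => i _; apply: coord_coface. Qed.

Lemma coord_twist_diff n (x : A n) p c : aug x = 1 ->
  coord (twist_diff x) p c = face_sum n (coord x ^~ c) p.
Proof.
move=> x1; rewrite twist_diff_aug1 // /coord mass_prod //.
- by apply: eq_bigr => i _; apply: coord_coface.
- by move=> i; rewrite aug_coface.
exact: entry_charD.
Qed.

Lemma coordM n (x y : A n) p c : aug x = 1 -> aug y = 1 ->
  coord (x * y) p c = coord x p c + coord y p c.
Proof.
move=> x1 y1; rewrite /coord massM //; last exact: entry_charD.
by rewrite x1 y1 !mul1r addrC.
Qed.

Lemma coordD n (x y : A n) p c : coord (x + y) p c = coord x p c + coord y p c.
Proof. exact: raddfD. Qed.

Definition entry_gen n (q : 'I_n * I) : {ffun 'I_n -> G} :=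
  [ffun p => if p == q.1 then e q.2 else 0].

Lemma entry_char_gen n (p q : 'I_n * I) :
  entry_char p.1 p.2 (entry_gen q) = (p == q).
Proof.
rewrite entry_char_ord ffunE; case: p q => p c [q d] /=.
rewrite xpair_eqE; case: eqP => _ /=; first exact: chi_e.
by rewrite (char0 (chiD c)).
Qed.

Lemma entry_charE n (g : {ffun 'I_n -> G}) :
  g = \sum_(q : 'I_n * I) (if entry_char q.1 q.2 g then entry_gen q else 0).
Proof.
apply/ffunP => p; rewrite sum_ffunE.
rewrite -(pair_bigA _ (fun (j : 'I_n) c =>
  (if entry_char j c g then entry_gen (j, c) else 0) p)) /=.
rewrite (bigD1 p) //= [X in _ + X]big1 ?addr0 => [|j jp].
  rewrite [LHS]chiE; apply: eq_bigr => c _; rewrite entry_char_ord.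
  by case: (chi c (g p)); rewrite ffunE //= eqxx.
rewrite big1 // => c _; case: ifP => _; rewrite ffunE //=.
by rewrite eq_sym (negPf jp).
Qed.

Lemma coord_lift n (w : nat -> I -> k) :
    (forall p c, (n <= p)%N -> w p c = 0) ->
  exists z : A n, aug z = 0 /\ forall p c, coord z p c = w p c.
Proof.
move=> w_supp.
exists (\sum_(q : 'I_n * I) w q.1 q.2 *: (gbase k (entry_gen q) + 1)); split.
  rewrite raddf_sum big1 // => q _.
  by rewrite /= massZ raddfD /= !mass_gbase (addrr_pchar2 char2) mulr0.
move=> p c; have [lt_pn|le_np] := ltnP p n; last by rewrite coord_out // w_supp.
pose q0 := (Ordinal lt_pn, c); rewrite /coord raddf_sum (bigD1 q0) //=.
have coordE (q : 'I_n * I) :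
    mass (@entry_char n p c) (w q.1 q.2 *: (gbase k (entry_gen q) + 1)) =
      w q.1 q.2 * (q0 == q)%:R.
  rewrite massZ raddfD /= !mass_gbase (entry_char_gen q0 q).
  by rewrite (char0 (@entry_charD _ _ _)) addr0.
rewrite [X in X + _](coordE q0) eqxx mulr1 big1 ?addr0 // => q ne_q.
by rewrite coordE eq_sym (negPf ne_q) mulr0.
Qed.

Lemma twist_pair_sum_injective n (u : A n) : aug u = 1 ->
  (forall p c, coord u p c = 0) -> (forall s, s != 0 -> pair_sum u s = 0) -> u = 1.
Proof.
move=> u1 cu; exact: (pair_sum_injective char2 (@addgg_ffun _ G2 _)
  (chi := fun q : 'I_n * I => entry_char q.1 q.2) (fun q => @entry_charD n q.1 q.2)
  (@entry_charE n) u1 (fun q => cu q.1 q.2)).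
Qed.

Lemma twist_pair_sum_surjective n (y : A n) : (forall p c, coord y p c = 0) ->
  exists w : A n, [/\ aug w = 1, forall p c, coord w p c = 0
  & exists c, pair_sum w = y + c%:A].
Proof.
move=> cy; have [w [w1 cw qw]] := pair_sum_surjective char2 (@addgg_ffun _ G2 _)
  (chi := fun q : 'I_n * I => entry_char q.1 q.2) (fun q => @entry_charD n q.1 q.2)
  (@entry_charE n) (fun q => cy q.1 q.2).
exists w; split=> // p c; have [lt_pn|le_np] := ltnP p n; last exact: coord_out.
exact: cw (Ordinal lt_pn, c).
Qed.

(** Acyclicity of the coordinates in degree m.+2, with the primitive realised
by an element of the group algebra. *)
Lemma coord_cocycle_lift m (v : nat -> I -> k) :
    (forall p c, (m.+2 <= p)%N -> v p c = 0) ->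
    (forall p c, face_sum m.+2 (v ^~ c) p = 0) ->
  exists z : A m.+1, aug z = 0 /\ forall p c, face_sum m.+1 (coord z ^~ c) p = v p c.
Proof.
move=> v_supp v_coc.
have [p c lt_mp|z [z0 cz]] :=
  coord_lift (n := m.+1) (w := fun p c => face_prim m (v ^~ c) p).
  by apply: (face_prim_supp char2) => // q; apply: v_supp.
exists z; split=> // p c; rewrite (eq_face_sum _ _ (cz ^~ c)).
by apply: (face_sum_prim char2) => // q; apply: v_supp.
Qed.

(** The logarithm of x is an additive coboundary d y; once y is
corrected to have coordinates 0 it is a logarithm itself, up to a constant that
the injectivity of the logarithm ignores. *)
Lemma cocycle_coord0 m (x : A m.+3) : aug x = 1 -> twist_diff x = 1 ->
    (forall p c, coord x p c = 0) ->
  exists2 y : A m.+2, aug y = 1 & twist_diff y = x.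
Proof.
move=> x1 dx cx.
have dq : add_diff (pair_sum x) = 0 by rewrite -pair_sum_twist_diff // dx pair_sum1.
pose y := contract (pair_sum x).
have dy : add_diff y = pair_sum x by exact: add_diff_contract.
have cdy p c : face_sum m.+2 (coord y ^~ c) p = 0.
  rewrite -coord_add_diff dy /coord.
  rewrite (mass_pair_sum char2 (@addgg_ffun _ G2 _) (@entry_charD _ p c)).
  by rewrite -/(coord x p c) cx mulr0 expr0n addr0.
have [p c|z [_ cz]] := coord_cocycle_lift _ cdy; first exact: coord_out.
pose y' : A m.+2 := y + add_diff z.
have dy' : add_diff y' = pair_sum x by rewrite add_diffD add_diffK // addr0.
have cy' p c : coord y' p c = 0.
  by rewrite coordD coord_add_diff cz (addrr_pchar2 char2).
have [w [w1 cw [c qw]]] := twist_pair_sum_surjective cy'.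
exists w => //; have dw1 := aug_twist_diff char2 G2 w1.
have cdw p d : coord (twist_diff w) p d = 0.
  rewrite coord_twist_diff // /face_sum big1 // => i _.
  by rewrite !cw !if_same.
suff : x * twist_diff w = 1.
  move=> xdw; rewrite -[LHS]mul1r -(aug1_sqr char2 _ x1) -?mulrA ?xdw ?mulr1 //.
  exact: addgg_ffun.
apply: twist_pair_sum_injective.
- by rewrite augM x1 dw1 mulr1.
- by move=> p d; rewrite coordM // cx cdw addr0.
move=> s s0; rewrite pair_sumM1 //; last exact: addgg_ffun.
rewrite pair_sum_twist_diff // qw add_diffD dy' addrA.
rewrite (addrr_pchar2 (galg_pchar2 _ char2)) add0r.
rewrite /add_diff sum_ffunE big1 // => i _.
by rewrite linearZ rmorph1 scaler_ffunE ffunE (negPf s0) mulr0.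
Qed.

(** The coordinates of x form a coboundary; 1 + z, where z lifts a primitive,
is a unit whose coboundary has the same coordinates as x. *)
Lemma cocycle_aug1 m (x : A m.+3) : aug x = 1 -> twist_diff x = 1 ->
  exists2 y : A m.+2, aug y = 1 & twist_diff y = x.
Proof.
move=> x1 dx.
have cdx p c : face_sum m.+3 (coord x ^~ c) p = 0.
  by rewrite -coord_twist_diff // dx /coord mass_gbase (char0 (@entry_charD _ _ _)).
have [p c|z [z0 cz]] := coord_cocycle_lift _ cdx; first exact: coord_out.
pose t : A m.+2 := 1 + z.
have t1 : aug t = 1 by rewrite raddfD /= aug1 z0 addr0.
have Ut : t \is a GRing.unit by apply: (aug1_unit char2) => //; apply: addgg_ffun.
have dt1 := aug_twist_diff char2 G2 t1.
have ct p c : coord (twist_diff t) p c = coord x p c.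
  rewrite coord_twist_diff // -cz; apply: eq_face_sum => q.
  by rewrite coordD /coord mass_gbase (char0 (@entry_charD _ _ _)) add0r.
(* So multiplying by twist_diff t divides by it. *)
have dt_sqr : twist_diff t * twist_diff t = 1.
  by apply: aug1_sqr => //; apply: addgg_ffun.
have [||p c|y y1 dy] := @cocycle_coord0 m (x * twist_diff t).
- by rewrite augM x1 dt1 mulr1.
- rewrite twist_diffM ?twist_diff_unit // ?dx ?twist_diffK ?mulr1 //.
  by apply: (aug1_unit char2) => //; apply: addgg_ffun.
- by rewrite coordM // ct (addrr_pchar2 char2).
exists (y * t); first by rewrite augM y1 t1 mulr1.
rewrite twist_diffM ?dy -?mulrA ?dt_sqr ?mulr1 //.
by apply: (aug1_unit char2) => //; apply: addgg_ffun.
Qed.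

(** Splitting off the augmentation c of x.  In odd degree the differential is
the identity on scalars and forces c = 1; in even degree c is the coboundary
of c. *)
Lemma cocycle_coboundary m (x : A m.+3) :
  x \is a GRing.unit -> twist_diff x = 1 ->
  exists2 y : A m.+2, y \is a GRing.unit & twist_diff y = x.
Proof.
move=> Ux dx; pose c := aug x; pose c' := aug x^-1.
have cc' : c * c' = 1 by rewrite /c /c' -augM mulrV // aug1.
have c'c : c' * c = 1 by rewrite mulrC.
have Uc n : (c%:A : A n) \is a GRing.unit.
  by apply/unitrPr; exists c'%:A; rewrite mulr_algl scalerA cc' scale1r.
pose x' := c'%:A * x.
have Uc' : (c'%:A : A m.+3) \is a GRing.unit.
  by apply/unitrPr; exists c%:A; rewrite mulr_algl scalerA c'c scale1r.
have x'1 : aug x' = 1 by rewrite /x' mulr_algl massZ.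
have def_x : x = c%:A * x'.
  by rewrite /x' mulrA [_ * c'%:A]mulr_algl scalerA cc' scale1r mul1r.
have dx' : twist_diff x' = if odd m.+3 then c'%:A else 1.
  by rewrite twist_diffM // dx mulr1 (twist_diff_alg _ _ c'c).
have [odd_m|even_m] := boolP (odd m.+3).
  rewrite odd_m in dx'.
  have c'1 : c' = 1.
    by have := aug_twist_diff char2 G2 x'1; rewrite dx' massZ aug1 mulr1.
  have [|y y1 dy] := cocycle_aug1 x'1; first by rewrite dx' c'1 scale1r.
  exists y; first by apply: (aug1_unit char2) => //; apply: addgg_ffun.
  by rewrite dy /x' c'1 scale1r mul1r.
rewrite (negPf even_m) in dx'; have [y y1 dy] := cocycle_aug1 x'1 dx'.
have Uy : y \is a GRing.unit by apply: (aug1_unit char2) => //; apply: addgg_ffun.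
exists (c%:A * y); first by rewrite unitrM Uc.
by rewrite twist_diffM // dy (twist_diff_alg _ _ cc') -[odd _]negbK even_m -def_x.
Qed.

Lemma twist_cohomology_trivial m :
  twist_cohomology k G m.+3 = [set coboundaries k G m.+3].
Proof.
have cosetE x : x \in @cocycles k G m.+3 ->
    [set x * b | b in @coboundaries k G m.+3] = @coboundaries k G m.+3.
  rewrite inE => -[Ux dx].
  have [y Uy dy] := cocycle_coboundary Ux dx.
  apply/seteqP; split=> [_ [_ [z Uz <-] <-]|_ [z Uz <-]].
    by exists (y * z); rewrite ?twist_diffM ?dy //= unitrM Uy.
  exists (twist_diff (y^-1 * z)).
    by exists (y^-1 * z) => //=; rewrite unitrM unitrV Uy.
  by rewrite -dy -twist_diffM ?unitrM ?unitrV ?Uy // mulVKr.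
apply/seteqP; split=> [_ [x cx <-]|_ ->].
  by apply: cosetE; rewrite inE.
have c1 : @cocycles k G m.+3 1.
  split; first exact: unitr1.
  by rewrite /twist_diff big1 // => i _; rewrite rmorph1 exp1rz.
by exists 1 => //; apply: cosetE; rewrite inE.
Qed.

End Coordinates.

Theorem theorem5p9 (k : comNzRingType) (r n : nat)
    (char2 : 2%N \in [pchar k]) (r_ge1 : (1 <= r)%N) (n_ge3 : (3 <= n)%N) :
  twist_cohomology k 'rV['Z_2]_r n = [set coboundaries k 'rV['Z_2]_r n].
Proof.
case: n n_ge3 => [|[|[|m]]] // _.
have Z2 (a : 'Z_2) : a != 0 -> a = 1 by case: a => -[|[|]] // ? _; apply: val_inj.
pose chi (c : 'I_r) (g : 'rV['Z_2]_r) := g 0 c != 0.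
apply: (@twist_cohomology_trivial _ _ char2 _ (fun c => delta_mx 0 c) chi).
- by move=> g; apply/rowP => c; rewrite !mxE; apply: addrr_pchar2.
- move=> c g h; rewrite /chi mxE.
  have [->|/Z2 ->] := eqVneq (g 0 c) 0; first by rewrite add0r.
  by have [->|/Z2 ->] := eqVneq (h 0 c) 0.
- by move=> c d; rewrite /chi mxE eqxx; case: (c == d).
move=> g; apply/rowP => c; rewrite summxE (bigD1 c) //= big1 ?addr0 => [|d dc].
  rewrite /chi; case: eqVneq => [->|/Z2 ->] /=; first by rewrite mxE.
  by rewrite mxE !eqxx.
by case: (chi d g); rewrite mxE // eq_sym (negPf dc) andbF.
Qed.
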